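(* Let $\mathscr{C}$ be a (small) dagger category with the property $(\ast)$ that all its morphisms are unitary, i.e. $f^\dag f=\mathrm{id}_A$ for every morphism $f:A\to B$. Then its twisted cyclic nerve $\widetilde{N\mathscr{C}^{\mathfrak{C}}}$ is a cyclic set, and its twisted dihedral nerve $\widetilde{N\mathscr{C}^{\mathfrak{D}}}$ is a dihedral set.
   Context: A dagger category is a category $\mathscr{C}$ with an involutive functor $\dag:\mathscr{C}^{op}\to\mathscr{C}$ that is the identity on objects: each $f:A\to B$ has $f^\dag:B\to A$ with $\mathrm{id}_A^\dag=\mathrm{id}_A$, $(g\circ f)^\dag=f^\dag\circ g^\dag$, $f^{\dag\dag}=f$. An example with property $(\ast)$ is any groupoid with $f^\dag=f^{-1}$. **Twisted cyclic nerve.** $\widetilde{N\mathscr{C}^{\mathfrak{C}}}$ has underlying simplicial set the classical nerve $N\mathscr{C}$: degree $n$ consists of diagrams $x_0\xrightarrow{a_1}x_1\xrightarrow{a_2}\cdots\xrightarrow{a_n}x_n$, with the usual faces ($d_i$ omits $x_i$, composing if $0<i<n$) and degeneracies ($s_i$ inserts $\mathrm{id}_{x_i}$). The operator $\tau_n$ sends this diagram to $$x_n\xrightarrow{(a_1\cdots a_n)^\dag}x_0\xrightarrow{a_1}\cdots\xrightarrow{a_{n-1}}x_{n-1},$$ where $a_1\cdots a_n:x_0\to x_n$ is the composite in diagrammatic order. **Twisted dihedral nerve.** $\widetilde{N\mathscr{C}^{\mathfrak{D}}}$ is $\widetilde{N\mathscr{C}^{\mathfrak{C}}}$ with, in addition,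 the operator $\omega_n$ sending the diagram to $x_n\xrightarrow{a_n^\dag}x_{n-1}\xrightarrow{a_{n-1}^\dag}\cdots\xrightarrow{a_1^\dag}x_0$. **Cyclic and dihedral sets.** A cyclic set is a simplicial set $X_\bullet$ with operators $\tau_n:X_n\to X_n$ satisfying $\tau_n^{n+1}=\mathrm{id}$; $d_i\tau_n=\tau_{n-1}d_{i-1}$ and $s_i\tau_n=\tau_{n+1}s_{i-1}$ for $1\le i\le n$; $d_0\tau_n=d_n$ and $s_0\tau_n=\tau_{n+1}^2s_n$ for $n\ge1$. A dihedral set is a cyclic set with in addition operators $\omega_n:X_n\to X_n$ satisfying $\omega_n^2=\mathrm{id}$; $(\tau_n\omega_n)^2=\mathrm{id}$; $d_i\omega_n=\omega_{n-1}d_{n-i}$ (for $n\ge1$) and $s_i\omega_n=\omega_{n+1}s_{n-i}$ for $0\le i\le n$. *)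

(* Defs.v *)
From mathcomp Require Import all_boot.

Set Implicit Arguments.
Unset Strict Implicit.
Unset Printing Implicit Defensive.

(* Composition is in diagrammatic order: [compm f g] is f followed by g. *)
Record category := Category {
  obj :> Type;
  hom : obj -> obj -> Type;
  idm : forall x, hom x x;
  compm : forall x y z, hom x y -> hom y z -> hom x z;
  compm_idl : forall x y (f : hom x y), compm (idm x) f = f;
  compm_idr : forall x y (f : hom x y), compm f (idm y) = f;
  compmA : forall x y z w (f : hom x y) (g : hom y z) (h : hom z w),
    compm f (compm g h) = compm (compm f g) h }.

Record dagger_category := DaggerCategory {
  dagger_cat :> category;
  dag : forall x y : dagger_cat, hom x y -> hom y x;
  dag_id : forall x : dagger_cat, dag (idm x) = idm x;
  dag_compm : forall (x y z : dagger_cat) (f : hom x y) (g : hom y z),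
    dag (compm f g) = compm (dag g) (dag f);
  dagK : forall (x y : dagger_cat) (f : hom x y), dag (dag f) = f }.

(* The law f^dag o f = id_x, read in diagrammatic order. *)
Definition all_unitary (C : dagger_category) : Prop :=
  forall (x y : C) (f : hom x y), compm f (dag f) = idm x.

Record simplicial_data := SimplicialData {
  cells :> nat -> Type;
  face : forall n, 'I_n.+2 -> cells n.+1 -> cells n;
  degen : forall n, 'I_n.+1 -> cells n -> cells n.+1 }.

Record cyclic_data := CyclicData {
  cyclic_simplicial :> simplicial_data;
  tau : forall n, cyclic_simplicial n -> cyclic_simplicial n }.

Record dihedral_data := DihedralData {
  dihedral_cyclic :> cyclic_data;
  omega : forall n, dihedral_cyclic n -> dihedral_cyclic n }.

(* In the axioms below the bounds always keep the index of a face or a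
   degeneracy in range, so that [inord] never takes its default value. *)
Local Notation d i := (face (inord i)).
Local Notation s i := (degen (inord i)).

Record is_simplicial_set (X : simplicial_data) : Prop := IsSimplicialSet {
  face_face : forall n i j (x : X n.+2), i < j <= n.+2 ->
    d i (d j x) = d j.-1 (d i x);
  degen_degen : forall n i j (x : X n), i <= j <= n ->
    s i (s j x) = s j.+1 (s i x);
  face_degen_lt : forall n i j (x : X n.+1), i < j <= n.+1 ->
    d i (s j x) = s j.-1 (d i x);
  face_degen_eq : forall n j (x : X n), j <= n -> d j (s j x) = x;
  face_degen_succ : forall n j (x : X n), j <= n -> d j.+1 (s j x) = x;
  face_degen_gt : forall n i j (x : X n.+1), j.+1 < i <= n.+2 ->
    d i (s j x) = s j (d i.-1 x) }.

Record is_cyclic_set (X : cyclic_data) : Prop := IsCyclicSet {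
  cyclic_is_simplicial : is_simplicial_set X;
  tau_order : forall n (x : X n), iter n.+1 (@tau X n) x = x;
  face_tau : forall n i (x : X n.+1), 1 <= i <= n.+1 ->
    d i (tau x) = tau (d i.-1 x);
  degen_tau : forall n i (x : X n), 1 <= i <= n ->
    s i (tau x) = tau (s i.-1 x);
  face0_tau : forall n (x : X n.+1), d 0 (tau x) = d n.+1 x;
  degen0_tau : forall n (x : X n), 1 <= n ->
    s 0 (tau x) = tau (tau (s n x)) }.

Record is_dihedral_set (X : dihedral_data) : Prop := IsDihedralSet {
  dihedral_is_cyclic : is_cyclic_set X;
  omegaK : forall n (x : X n), omega (omega x) = x;
  tau_omegaK : forall n (x : X n), tau (omega (tau (omega x))) = x;
  face_omega : forall n i (x : X n.+1), i <= n.+1 ->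
    d i (omega x) = omega (d (n.+1 - i) x);
  degen_omega : forall n i (x : X n), i <= n ->
    s i (omega x) = omega (s (n - i) x) }.

(* [chain C n x] is the type of diagrams x = x_0 -> x_1 -> ... -> x_n. *)
Fixpoint chain (C : category) (n : nat) (x : C) : Type :=
  if n is m.+1 then {y : C & (hom x y * chain m y)%type} else unit.

Section Chains.
Variable C : category.

Definition cons_chain n (x y : C) (f : hom x y) (c : chain n y) :
  chain n.+1 x := existT _ y (f, c).

Fixpoint target n : forall x : C, chain n x -> C :=
  match n with
  | 0 => fun x _ => x
  | m.+1 => fun _ '(existT _ (_, c)) => target c
  end.

Fixpoint composite n : forall (x : C) (c : chain n x), hom x (target c) :=
  match n with
  | 0 => fun x _ => idm x
  | m.+1 => fun _ '(existT _ (f, c)) => compm f (composite c)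
  end.

(* x_0 -> ... -> x_n, from x_0 -> ... -> x_n+1 *)
Fixpoint init_chain n : forall x : C, chain n.+1 x -> chain n x :=
  match n with
  | 0 => fun _ _ => tt
  | m.+1 => fun _ '(existT _ (f, c)) => cons_chain f (init_chain c)
  end.

Fixpoint last_arrow n : forall (x : C) (c : chain n.+1 x),
    hom (target (init_chain c)) (target c) :=
  match n with
  | 0 => fun _ '(existT _ (f, _)) => f
  | m.+1 => fun _ '(existT _ (_, c)) => last_arrow c
  end.

(* Omits x_i+1, for i <= n: composes at it if i < n, drops a_n+1 if i = n. *)
Fixpoint omit_succ n (i : nat) : forall x : C, chain n.+1 x -> chain n x :=
  match n with
  | 0 => fun _ _ => tt
  | m.+1 => fun _ '(existT _ (f, c)) =>
      if i is j.+1 then cons_chain f (omit_succ j c)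
      else let: existT _ (g, c') := c in cons_chain (compm f g) c'
  end.

(* Inserts the identity of x_i, for i <= n. *)
Fixpoint insert_id n (i : nat) : forall x : C, chain n x -> chain n.+1 x :=
  match n with
  | 0 => fun x c => cons_chain (idm x) c
  | m.+1 => fun x c =>
      if i is j.+1 then
        let: existT _ (f, c') := c in cons_chain f (insert_id j c')
      else cons_chain (idm x) c
  end.

Definition simplex (n : nat) : Type := {x : C & chain n x}.

Definition nerve_face n (i : 'I_n.+2) (u : simplex n.+1) : simplex n :=
  let: existT x c := u in
  if i : nat is j.+1 then existT _ x (omit_succ j c)
  else let: existT y (_, c') := c in existT _ y c'.

Definition nerve_degen n (i : 'I_n.+1) (u : simplex n) : simplex n.+1 :=
  let: existT x c := u in existT _ x (insert_id i c).

End Chains.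

Definition nerve (C : category) : simplicial_data :=
  SimplicialData (@nerve_face C) (@nerve_degen C).

Section TwistedNerve.
Variable C : dagger_category.

(* In degree 0 the diagram has no arrows, so the operator is the identity. *)
Definition twisted_tau n : simplex C n -> simplex C n :=
  match n with
  | 0 => fun u => u
  | m.+1 => fun '(existT _ c) =>
      existT _ (target c) (cons_chain (dag (composite c)) (init_chain c))
  end.

Fixpoint dag_rev n : forall (x : C) (c : chain n x), chain n (target c) :=
  match n with
  | 0 => fun _ _ => tt
  | m.+1 => fun _ c => cons_chain (dag (last_arrow c)) (dag_rev (init_chain c))
  end.

Definition twisted_omega n (u : simplex C n) : simplex C n :=
  let: existT _ c := u in existT _ (target c) (dag_rev c).

Definition twisted_cyclic_nerve : cyclic_data :=
  @CyclicData (nerve C) twisted_tau.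

Definition twisted_dihedral_nerve : dihedral_data :=
  @DihedralData twisted_cyclic_nerve twisted_omega.

End TwistedNerve.

(* Main.v *)
Require Import Defs.
From mathcomp Require Import all_boot.
From mathcomp Require Import zify.

(** When all morphisms are unitary, C is a groupoid with inverse [dag], so
    an n-simplex extends to a functor from an indiscrete groupoid on the
    vertices: it has an arrow between any two vertices, in either direction.
    Every operator then merely reindexes vertices ([tau] by a rotation,
    [omega] by a reversal), and each required identity reduces to an identity
    between maps of indices. *)

Set Implicit Arguments.
Unset Strict Implicit.
Unset Printing Implicit Defensive.

(** Indexing by all of [nat] lets one clique serve every dimension and makes each reindexing a plain
    map on [nat]. *)
Record clique (C : dagger_category) := Clique {
  vert : nat -> C;
  arr : forall i j, hom (vert i) (vert j);
  arr_id : forall i, arr i i = idm (vert i);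
  arr_comp : forall i j k, compm (arr i j) (arr j k) = arr i k;
  arr_dag : forall i j, dag (arr i j) = arr j i }.

Definition scons (i : nat) (h : nat -> nat) (k : nat) : nat :=
  if k is l.+1 then h l else i.

(** * The operators on chains read off a clique *)

Section Walks.
Variables (C : dagger_category) (K : clique C).

(* The first index is a separate argument, so that changing the other ones
   does not change the type. *)
Fixpoint walk n (i : nat) (h : nat -> nat) : chain n (vert K i) :=
  match n with
  | 0 => tt
  | m.+1 => cons_chain (arr K i (h 0)) (walk m (h 0) (fun k => h k.+1))
  end.

Definition walk_simplex n (h : nat -> nat) : simplex C n :=
  existT _ (vert K (h 0)) (walk n (h 0) (fun k => h k.+1)).

Lemma eq_walk n i (h h' : nat -> nat) :
  (forall k, k < n -> h k = h' k) -> walk n i h = walk n i h'.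
Proof.
elim: n i h h' => [|n IHn] i h h' eq_h //=.
rewrite (IHn _ _ (fun k => h' k.+1)) => [|k lt_kn]; last exact: eq_h.
by rewrite (eq_h 0).
Qed.

Lemma eq_walk_simplex n (h h' : nat -> nat) :
  (forall k, k <= n -> h k = h' k) -> walk_simplex n h = walk_simplex n h'.
Proof.
move=> eq_h; rewrite /walk_simplex.
rewrite (@eq_walk _ _ _ (fun k => h' k.+1)) => [|k lt_kn]; last exact: eq_h.
by rewrite (eq_h 0).
Qed.

Lemma omit_succ_walk n i h j : j <= n ->
  omit_succ j (walk n.+1 i h) = walk n i (fun k => h (bump j k)).
Proof.
elim: n i h j => [|n IHn] i h [|j] //= le_jn; first by rewrite arr_comp.
rewrite -/(walk n.+1 (h 0) (fun k => h k.+1)) IHn //.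
rewrite (@eq_walk _ _ _ (fun k => h (bump j.+1 k.+1))) // => k _.
by rewrite bumpS.
Qed.

Lemma insert_id_walk n i h j : j <= n ->
  insert_id j (walk n i h) = walk n.+1 i (fun k => scons i h (unbump j k.+1)).
Proof.
elim: n i h j => [|n IHn] i h [|j] // le_jn.
- by rewrite /= arr_id.
- rewrite [LHS]/= -/(walk n.+1 i h) -arr_id.
  by rewrite (@eq_walk _ _ _ (fun k => scons i h k.+1)).
rewrite [LHS]/= IHn //.
rewrite (@eq_walk _ _ _ (fun k => scons i h (unbump j.+1 k.+2))) // => k _.
by rewrite unbumpS; case: (unbump _ _).
Qed.

Lemma init_chain_walk n i h : init_chain (walk n.+1 i h) = walk n i h.
Proof.
elim: n i h => [|n IHn] i h //.
by rewrite [RHS]/= -IHn.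
Qed.

(** For variable [n] the target of a walk is not convertible to a vertex of [K], so it travels with
    the composite in a dependent pair. The inductive step maps a function over the pair of the
    induction hypothesis. *)
Lemma composite_walk n i h :
  existT (hom (vert K i)) (target (walk n i h)) (composite (walk n i h)) =
  existT _ (vert K (scons i h n)) (arr K i (scons i h n)).
Proof.
elim: n i h => [|n IHn] i h; first by rewrite /= arr_id.
pose precomp (s : {y : C & hom (vert K (h 0)) y}) :=
  existT (hom (vert K i)) _ (compm (arr K i (h 0)) (projT2 s)).
apply: etrans (congr1 precomp (IHn (h 0) (fun k => h k.+1))) _.
by rewrite /precomp /= arr_comp; case: n {IHn}.
Qed.

Fixpoint target_arr n i h j : hom (target (walk n i h)) (vert K j) :=
  match n with
  | 0 => arr K i j
  | m.+1 => target_arr m (h 0) (fun k => h k.+1) j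
  end.

(* Packing the data over the initial chain lets them be rewritten together,
   without any uniqueness of identity proofs for the objects. *)
Definition last_pack n x j (d : chain n x) (y : C) (f : hom (target d) y)
    (g : hom y (vert K j)) :
  {d : chain n x & {y : C & (hom (target d) y * hom y (vert K j))%type}} :=
  existT _ d (existT _ y (f, g)).

Lemma last_arrow_walk n i h j :
  last_pack (last_arrow (walk n.+1 i h)) (target_arr n.+1 i h j) =
  last_pack (target_arr n i h (h n)) (arr K (h n) j).
Proof.
elim: n i h => [|n IHn] i h //.
pose f := arr K i (h 0).
pose ext (s : {d : chain n (vert K (h 0)) &
              {y : C & (hom (target d) y * hom y (vert K j))%type}}) :=
  let: existT d (existT y (a, b)) := s in
  @last_pack n.+1 (vert K i) j (cons_chain f d) y a b.
have eq_ext := congr1 ext (IHn (h 0) (fun k => h k.+1)).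
exact: eq_ext.
Qed.

(** The extra arrow to an arbitrary vertex [j] strengthens the induction: at [j = h n] it is the
    last arrow of the longer walk, whose dagger begins the reversed chain. *)
Lemma dag_rev_walk n i h j :
  existT (fun y => (hom y (vert K j) * chain n y)%type)
    (target (walk n i h)) (target_arr n i h j, dag_rev (walk n i h)) =
  existT _ (vert K (scons i h n))
    (arr K (scons i h n) j,
     walk n (scons i h n) (fun k => scons i h (n - k.+1))).
Proof.
elim: n i h j => [|n IHn] i h j //.
pose rev_pack (s : {d : chain n (vert K i) &
                   {y : C & (hom (target d) y * hom y (vert K j))%type}}) :=
  let: existT d (existT y (a, b)) := s in
  existT (fun y => (hom y (vert K j) * chain n.+1 y)%type) y
    (b, cons_chain (dag a) (dag_rev d)).
apply: etrans (congr1 rev_pack (last_arrow_walk n i h j)) _.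
pose cons_pack (s : {y : C & (hom y (vert K (h n)) * chain n y)%type}) :=
  let: existT y (a, c) := s in
  existT (fun y => (hom y (vert K j) * chain n.+1 y)%type) (vert K (h n))
    (arr K (h n) j, cons_chain (dag a) c).
apply: etrans (congr1 cons_pack (IHn i h (h n))) _.
by rewrite /cons_pack arr_dag [walk n.+1 _ _]/= subn1.
Qed.

(** Here [bump i] is the i-th coface map and, in [degen_walk], [unbump i] is the i-th codegeneracy;
    [arr_comp] and [arr_id] absorb the composed arrows and inserted identities. *)
Lemma face_walk n i h : i <= n.+1 ->
  face (inord i) (walk_simplex n.+1 h : nerve C n.+1) =
  walk_simplex n (fun k => h (bump i k)).
Proof.
move=> le_in; rewrite /= inordK //; case: i le_in => [|i] le_in //.
rewrite -/(walk n.+1 (h 0) (fun k => h k.+1)) omit_succ_walk //.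
rewrite /walk_simplex; congr existT.
by apply: eq_walk => k _; rewrite bumpS.
Qed.

Lemma degen_walk n i h : i <= n ->
  degen (inord i) (walk_simplex n h : nerve C n) =
  walk_simplex n.+1 (fun k => h (unbump i k)).
Proof.
move=> le_in; rewrite [LHS]/= inordK // insert_id_walk // /walk_simplex.
have -> : unbump i 0 = 0 by [].
by congr existT; apply: eq_walk => k _; case: (unbump i k.+1).
Qed.

(** The map [scons n id] is the rotation of 0, ..., n that lowers each index by 1 and wraps 0 around
    to n. *)
Lemma tau_walk n h :
  tau (walk_simplex n h : twisted_cyclic_nerve C n) =
  walk_simplex n (fun k => h (scons n id k)).
Proof.
case: n => [|n] //.
rewrite [LHS]/= -/(walk n.+1 (h 0) (fun k => h k.+1)) init_chain_walk.
pose tau_pack (s : {y : C & hom (vert K (h 0)) y}) : simplex C n.+1 :=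
  existT _ (projT1 s)
    (cons_chain (dag (projT2 s)) (walk n (h 0) (fun k => h k.+1))).
apply: etrans (congr1 tau_pack (composite_walk n.+1 (h 0) (fun k => h k.+1))) _.
by rewrite /tau_pack /= arr_dag.
Qed.

Lemma omega_walk n h :
  omega (walk_simplex n h : twisted_dihedral_nerve C n) =
  walk_simplex n (fun k => h (n - k)).
Proof.
have scons_h k : scons (h 0) (fun k => h k.+1) k = h k by case: k.
pose rev_simplex (s : {y : C & (hom y (vert K 0) * chain n y)%type}) :
  simplex C n := existT _ (projT1 s) (projT2 s).2.
(* The final index 0 is arbitrary, since [rev_simplex] discards the auxiliary arrow. *)
apply: etrans (congr1 rev_simplex (dag_rev_walk n (h 0) (fun k => h k.+1) 0)) _.
rewrite /rev_simplex /walk_simplex /= subn0 scons_h; congr existT.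
by apply: eq_walk => k _; rewrite scons_h.
Qed.

Lemma iter_tau_walk n j h :
  iter j (@tau (twisted_cyclic_nerve C) n) (walk_simplex n h) =
  walk_simplex n (fun k => h (iter j (scons n id) k)).
Proof.
elim: j => [|j IHj] //; rewrite iterS IHj tau_walk.
by apply: eq_walk_simplex => k _; rewrite iterSr.
Qed.

End Walks.

(** * Every simplex comes from a clique *)

Section Extension.
Variables (C : dagger_category) (C_unitary : all_unitary C).

Lemma dag_compm_id (x y : C) (f : hom x y) : compm (dag f) f = idm y.
Proof. by rewrite -{2}(dagK f) C_unitary. Qed.

Section ExtendClique.
Variables (K : clique C) (x : C) (f : hom x (vert K 0)).

Definition ext_vert i := if i is k.+1 then vert K k else x.

Definition ext_arr i j : hom (ext_vert i) (ext_vert j) :=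
  match i, j with
  | 0, 0 => idm x
  | 0, l.+1 => compm f (arr K 0 l)
  | k.+1, 0 => compm (arr K k 0) (dag f)
  | k.+1, l.+1 => arr K k l
  end.

Lemma ext_arr_id i : ext_arr i i = idm (ext_vert i).
Proof. by case: i => [|i] //=; exact: arr_id. Qed.

Lemma ext_arr_comp i j k : compm (ext_arr i j) (ext_arr j k) = ext_arr i k.
Proof.
case: i j k => [|i] [|j] [|k] /=; rewrite ?compm_idl ?compm_idr //.
- by rewrite compmA -(compmA f) arr_comp arr_id compm_idr C_unitary.
- by rewrite -compmA arr_comp.
- by rewrite compmA -(compmA (arr K i 0)) dag_compm_id compm_idr arr_comp.
- by rewrite compmA arr_comp.
- by rewrite arr_comp.
Qed.

Lemma ext_arr_dag i j : dag (ext_arr i j) = ext_arr j i.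
Proof.
by case: i j => [|i] [|j] /=; rewrite ?dag_id ?dag_compm ?dagK ?arr_dag.
Qed.

Definition ext_clique := Clique ext_arr_id ext_arr_comp ext_arr_dag.

Lemma walk_ext_clique n i h :
  walk ext_clique n i.+1 (fun k => (h k).+1) = walk K n i h.
Proof. by elim: n i h => [|n IHn] i h //=; rewrite -IHn. Qed.

End ExtendClique.

Definition const_clique (x : C) : clique C :=
  @Clique C (fun=> x) (fun _ _ => idm x) (fun=> erefl)
    (fun _ _ _ => compm_idl (idm x)) (fun _ _ => dag_id x).

(** By induction, a clique for the tail gains a new vertex 0, joined to the others through the first
    arrow and its dagger; unitarity makes these mutually inverse. Indices beyond n repeat the last
    vertex. *)
Lemma walk_simplexP n (u : simplex C n) :
  exists K : clique C, u = walk_simplex K n id.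
Proof.
elim: n u => [|n IHn] [x c]; first by exists (const_clique x); case: c.
case: c => y [f c]; have [K def_c] := IHn (existT _ y c).
(* Writing [y] and [c] as projections of one pair lets the elimination of [def_c] replace both, and
   the type of [f], at once. *)
rewrite -[y]/(projT1 (existT (fun z => chain n z) y c)) in f *.
rewrite -[c in (_, c)]/(projT2 (existT (fun z => chain n z) y c)).
case: _ / (esym def_c) f => f; exists (ext_clique f).
rewrite /walk_simplex /= (walk_ext_clique f n 0 succn) /=.
by rewrite arr_id compm_idr.
Qed.

End Extension.

(** * The axioms as identities between index maps *)

Lemma nerve_simplicial (C : dagger_category) :
  all_unitary C -> is_simplicial_set (nerve C).
Proof.
move=> C_unitary.
split=> [n i j u ij|n i j u ij|n i j u ij|n j u jn|n j u jn|n i j u ij];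
  have [K ->] := walk_simplexP C_unitary u;
  (rewrite !(face_walk, degen_walk); try lia);
  by apply: eq_walk_simplex => k _; rewrite /bump /unbump; lia.
Qed.

Lemma scons_idE n k : scons n id k = if k == 0 then n else k.-1.
Proof. by case: k. Qed.

Lemma iter_rotation_sub n i j : iter i (scons n id) (i + j) = j.
Proof. by elim: i => // i IHi; rewrite iterSr. Qed.

Lemma iter_rotation n k : k <= n -> iter n.+1 (scons n id) k = k.
Proof.
(* From k, k steps lead down to 0, one step wraps to n, and n - k steps lead back to k. *)
move=> le_kn; have -> : n.+1 = (n - k) + (1 + k) by lia.
rewrite !iterD -{3}(addn0 k) iter_rotation_sub /=.
by rewrite -{3}(subnK le_kn) iter_rotation_sub.
Qed.

Lemma twisted_cyclic_nerve_cyclic (C : dagger_category) :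
  all_unitary C -> is_cyclic_set (twisted_cyclic_nerve C).
Proof.
move=> C_unitary; split=> [|n u|n i u i_n|n i u i_n|n u|n u n_gt0];
  first exact: nerve_simplicial.
all: have [K ->] := walk_simplexP C_unitary u.
- rewrite iter_tau_walk; apply: eq_walk_simplex => k le_kn.
  exact: iter_rotation.
- rewrite tau_walk !face_walk ?tau_walk; [|lia..].
  apply: eq_walk_simplex => k le_kn; rewrite !scons_idE /bump.
  by do ?case: eqP; lia.
- rewrite tau_walk !degen_walk ?tau_walk; [|lia..].
  apply: eq_walk_simplex => k le_kn; rewrite !scons_idE /unbump.
  by do ?case: eqP; lia.
- rewrite tau_walk !face_walk; [|lia..].
  apply: eq_walk_simplex => k le_kn; rewrite !scons_idE /bump.
  by do ?case: eqP; lia.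
- rewrite tau_walk !degen_walk ?tau_walk; [|lia..].
  apply: eq_walk_simplex => k le_kn; rewrite !scons_idE /unbump.
  by do ?case: eqP; lia.
Qed.

Theorem theorem4p6 (C : dagger_category) (C_unitary : all_unitary C) :
  is_cyclic_set (twisted_cyclic_nerve C) /\
  is_dihedral_set (twisted_dihedral_nerve C).
Proof.
have cyclic := twisted_cyclic_nerve_cyclic C_unitary.
split=> //; split=> // n.
- move=> u; have [K ->] := walk_simplexP C_unitary u.
  rewrite !omega_walk; apply: eq_walk_simplex => k; exact: subKn.
- move=> u; have [K ->] := walk_simplexP C_unitary u.
  rewrite omega_walk tau_walk omega_walk tau_walk.
  (* With r the rotation, the index map is k to n - r(n - r(k)). At k = 0 both uses of r wrap
     around; otherwise n - r(k) is positive and both just subtract 1. *)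
  apply: eq_walk_simplex => -[|k] le_kn /=; first by rewrite subnn /= subnn.
  by rewrite -(subnSK le_kn) /= subKn.
- move=> i u i_n; have [K ->] := walk_simplexP C_unitary u.
  rewrite omega_walk !face_walk ?omega_walk; [|lia..].
  by apply: eq_walk_simplex => k le_kn; rewrite /bump; lia.
- move=> i u i_n; have [K ->] := walk_simplexP C_unitary u.
  rewrite omega_walk !degen_walk ?omega_walk; [|lia..].
  by apply: eq_walk_simplex => k le_kn; rewrite /unbump; lia.
Qed.
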